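(* Let $Q\in\mathbb{R}^{n\times n}$, $Q\succeq0$, $R\in\mathbb{R}^{m\times m}$, $R\succ0$, $\sigma_w>0$, $\lambda\ge0$, and let $\Psi,\Psi_1,\Psi_2,\bar X_1,\hat A,\hat B$ be the matrices defined in the context. Consider the indirect problem $$ \begin{aligned} \min_{K,\ \Sigma\succeq 0}\quad & \operatorname{Tr}\bigl((Q+K^\top R K)\Sigma\bigr)+\lambda\operatorname{Tr}\left(\begin{bmatrix}K^\top & I_n\end{bmatrix}\Psi^{-1}\begin{bmatrix}K\\ I_n\end{bmatrix}\Sigma\right)\\ \text{s.t.}\quad & \Sigma=\sigma_w^2 I_n+\begin{bmatrix}\hat B & \hat A\end{bmatrix}\begin{bmatrix}K\\ I_n\end{bmatrix}\Sigma\begin{bmatrix}K\\ I_n\end{bmatrix}^\top\begin{bmatrix}\hat B & \hat A\end{bmatrix}^\top \end{aligned} $$ over $K\in\mathbb{R}^{m\times n}$ and symmetric $\Sigma\in\mathbb{R}^{n\times n}$, and the direct problem $$ \begin{aligned} \min_{V,\ \Sigma\succeq 0}\quad & \operatorname{Tr}\bigl((Q+V^\top\Psi_1^\top R\Psi_1V)\Sigma\bigr)+\lambda\operatorname{Tr}(\Psi V\Sigma V^\top)\\ \text{s.t.}\quad & \Sigma=\sigma_w^2I_n+\bar X_1V\Sigma V^\top\bar X_1^\top,\qquad I_n=\Psi_2V \end{aligned} $$ over $V\in\mathbb{R}^{(n+m)\times n}$ and symmetric $\Sigma\in\mathbb{R}^{n\times n}$, with associated gain $K=\Psi_1V$. Then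 the two problems are equivalent in the sense that their solutions coincide: $(K,\Sigma)$ is an optimal solution of the indirect problem if and only if there is a $V$ with $K=\Psi_1V$ such that $(V,\Sigma)$ is an optimal solution of the direct problem.
   Context: Data matrices $X_0\in\mathbb{R}^{n\times T}$, $U_0\in\mathbb{R}^{m\times T}$, $X_1\in\mathbb{R}^{n\times T}$ are given (states, inputs, successor states of a linear system $x_{k+1}=Ax_k+Bu_k+w_k$ with noise variance $\sigma_w^2I_n$), with $D_0=\begin{bmatrix} U_0 \\ X_0 \end{bmatrix}\in\mathbb{R}^{(m+n)\times T}$ satisfying $\operatorname{rank}(D_0)=n+m$. Prior parameters: $[\bar B\ \ \bar A]$ with $\bar B\in\mathbb{R}^{n\times m}$, $\bar A\in\mathbb{R}^{n\times n}$, and $\Omega=\begin{bmatrix}\Omega_B&0\\0&\Omega_A\end{bmatrix}\succeq0$ with $\Omega_B\in\mathbb{R}^{m\times m}$, $\Omega_A\in\mathbb{R}^{n\times n}$. Define $$\Psi=(D_0D_0^\top+\sigma_w^2\Omega)/T\succ0,\qquad \Psi=\begin{bmatrix}\Psi_1\\ \Psi_2\end{bmatrix},\ \Psi_1\in\mathbb{R}^{m\times(n+m)},\ \Psi_2\in\mathbb{R}^{n\times(n+m)},$$ $$\bar X_1=\tfrac1T\bigl(X_1D_0^\top+\sigma_w^2[\bar B\ \ \bar A]\Omega\bigr)\in\mathbb{R}^{n\times(n+m)},\qquad [\hat B\ \ \hat A]=\bar X_1\Psi^{-1}$$ with $\hat B\in\mathbb{R}^{n\times m}$, $\hat A\in\mathbb{R}^{n\times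 n}$. ($[\hat B\ \ \hat A]$ is the posterior mean of $[B\ \ A]$, equivalently the minimizer over $[B\ \ A]$ of $\frac1{\sigma_w^2}\|X_1-[B\ \ A]D_0\|_F^2+\|([B\ \ A]-[\bar B\ \ \bar A])\Omega^{1/2}\|_F^2$.) *)

(* Defs.v *)
From HB Require Import structures.
From mathcomp Require Import all_boot all_order all_algebra.
From mathcomp Require Import reals.

Set Implicit Arguments.
Unset Strict Implicit.
Unset Printing Implicit Defensive.

Import Order.TTheory GRing.Theory Num.Theory.
Local Open Scope ring_scope.

Definition psdmx (F : realType) (n : nat) (A : 'M[F]_n) : Prop :=
  A^T = A /\ forall x : 'cV[F]_n, 0 <= (x^T *m A *m x) 0 0.

Definition pdmx (F : realType) (n : nat) (A : 'M[F]_n) : Prop :=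
  A^T = A /\ forall x : 'cV[F]_n, x != 0 -> 0 < (x^T *m A *m x) 0 0.

Definition is_minimizer (F : realType) (X : Type)
    (feasible : X -> Prop) (cost : X -> F) (x : X) : Prop :=
  feasible x /\ forall y : X, feasible y -> cost x <= cost y.

(* Data come as D0 = [U0; X0] and prior means as Mbar = [Bbar Abar]: inputs
   occupy the first m coordinates, states the last n. *)

Definition Psi_mx (F : realType) (m n T : nat) (sigma_w : F)
    (D0 : 'M[F]_(m + n, T)) (Omega : 'M[F]_(m + n)) : 'M[F]_(m + n) :=
  T%:R^-1 *: (D0 *m D0^T + sigma_w ^+ 2 *: Omega).

Definition X1bar_mx (F : realType) (m n T : nat) (sigma_w : F)
    (X1 : 'M[F]_(n, T)) (D0 : 'M[F]_(m + n, T))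
    (Mbar : 'M[F]_(n, m + n)) (Omega : 'M[F]_(m + n)) : 'M[F]_(n, m + n) :=
  T%:R^-1 *: (X1 *m D0^T + sigma_w ^+ 2 *: (Mbar *m Omega)).

(* The variables of each problem are pairs: p = (K, Sigma) for the indirect
   problem and p = (V, Sigma) for the direct one. *)

Definition indirect_feasible (F : realType) (m n : nat) (sigma_w : F)
    (Bhat : 'M[F]_(n, m)) (Ahat : 'M[F]_n)
    (p : 'M[F]_(m, n) * 'M[F]_n) : Prop :=
  let: (K, Sigma) := p in
  psdmx Sigma /\
  Sigma = (sigma_w ^+ 2)%:M
          + row_mx Bhat Ahat *m col_mx K 1%:M *m Sigma
            *m (col_mx K 1%:M)^T *m (row_mx Bhat Ahat)^T.

Definition indirect_cost (F : realType) (m n : nat)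
    (Q : 'M[F]_n) (R : 'M[F]_m) (lambda : F) (Psi : 'M[F]_(m + n))
    (p : 'M[F]_(m, n) * 'M[F]_n) : F :=
  let: (K, Sigma) := p in
  \tr ((Q + K^T *m R *m K) *m Sigma)
  + lambda * \tr (row_mx K^T 1%:M *m invmx Psi *m col_mx K 1%:M *m Sigma).

Definition direct_feasible (F : realType) (m n : nat) (sigma_w : F)
    (Psi : 'M[F]_(m + n)) (X1bar : 'M[F]_(n, m + n))
    (p : 'M[F]_(m + n, n) * 'M[F]_n) : Prop :=
  let: (V, Sigma) := p in
  [/\ psdmx Sigma,
      Sigma = (sigma_w ^+ 2)%:M + X1bar *m V *m Sigma *m V^T *m X1bar^T
    & 1%:M = dsubmx Psi *m V].

Definition direct_cost (F : realType) (m n : nat)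
    (Q : 'M[F]_n) (R : 'M[F]_m) (lambda : F) (Psi : 'M[F]_(m + n))
    (p : 'M[F]_(m + n, n) * 'M[F]_n) : F :=
  let: (V, Sigma) := p in
  \tr ((Q + V^T *m (usubmx Psi)^T *m R *m usubmx Psi *m V) *m Sigma)
  + lambda * \tr (Psi *m V *m Sigma *m V^T).

(* Main.v *)
(** The matrix [Psi] is symmetric and invertible, because [D0] has full row
    rank.  The constraint [Psi_2 V = I] therefore says exactly that
    [V = Psi^-1 [K; I]] with [K = Psi_1 V], and this change of variables carries
    the feasible set and the cost of the indirect problem to those of the direct
    one. *)

Require Import Defs.
From mathcomp Require Import all_boot all_order all_algebra.
From mathcomp Require Import reals.

Set Implicit Arguments.
Unset Strict Implicit.
Unset Printing Implicit Defensive.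

Import Order.TTheory GRing.Theory Num.Theory.
Local Open Scope ring_scope.

(** Since [f] reaches every feasible point of [Y] and preserves feasibility and cost, the
    competitors on both sides offer the same costs. *)
Lemma is_minimizer_img (F : realType) (X Y : Type) (f : X -> Y)
    (feasX : X -> Prop) (feasY : Y -> Prop) (costX : X -> F) (costY : Y -> F) :
  (forall x, feasX x <-> feasY (f x)) ->
  (forall y, feasY y -> exists x, y = f x) ->
  (forall x, costY (f x) = costX x) ->
  forall x, is_minimizer feasX costX x <-> is_minimizer feasY costY (f x).
Proof.
move=> feasE surj costE x; split=> -[feas_x min_x]; split; try exact/feasE.
- move=> y feas_y; have [z eq_y] := surj y feas_y.
  by rewrite eq_y !costE; apply/min_x/feasE; rewrite -eq_y.
- by move=> y feas_y; rewrite -!costE; apply/min_x/feasE.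
Qed.

Lemma mulmx_trE (F : realType) (n : nat) (u : 'rV[F]_n) :
  (u *m u^T) 0 0 = \sum_j u 0 j ^+ 2.
Proof. by rewrite mxE; apply: eq_bigr => j _; rewrite mxE expr2. Qed.

Lemma mulmx_tr_ge0 (F : realType) (n : nat) (u : 'rV[F]_n) :
  0 <= (u *m u^T) 0 0.
Proof. by rewrite mulmx_trE; apply: sumr_ge0 => j _; apply: sqr_ge0. Qed.

(** A sum of squares that is at most zero has only zero terms. The inequality is the form in which
    the bound on [v *m D0] arises below. *)
Lemma mulmx_tr_le0 (F : realType) (n : nat) (u : 'rV[F]_n) :
  (u *m u^T) 0 0 <= 0 -> u = 0.
Proof.
move=> uu_le0; have /eqP : (u *m u^T) 0 0 = 0.
  by apply/le_anti; rewrite uu_le0 mulmx_tr_ge0.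
rewrite mulmx_trE psumr_eq0 => [/allP u0|j _]; last exact: sqr_ge0.
apply/rowP => j; rewrite mxE; apply/eqP.
by have := u0 j (mem_index_enum j); rewrite sqrf_eq0.
Qed.

Lemma Psi_mx_sym (F : realType) (m n T : nat) (sigma_w : F)
    (D0 : 'M[F]_(m + n, T)) (Omega : 'M[F]_(m + n)) :
  psdmx Omega -> (Psi_mx sigma_w D0 Omega)^T = Psi_mx sigma_w D0 Omega.
Proof.
case=> symO _.
by rewrite /Psi_mx linearZ linearD /= trmx_mul trmxK linearZ /= symO.
Qed.

(** If [v] annihilates [Psi] from the left, then the squared norm of [v *m D0] equals minus
    [sigma_w ^+ 2] times the form of [Omega] at [v], hence is at most zero. So [v *m D0 = 0], and
    full row rank of [D0] gives [v = 0]. *)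
Lemma Psi_mx_unit (F : realType) (m n T : nat) (sigma_w : F)
    (D0 : 'M[F]_(m + n, T)) (Omega : 'M[F]_(m + n)) :
  row_free D0 -> psdmx Omega -> Psi_mx sigma_w D0 Omega \in unitmx.
Proof.
move=> freeD [_ psdO]; rewrite -row_free_unit -kermx_eq0.
apply/rowV0P => v /sub_kermxP vPsi0.
suff vD0 : v *m D0 = 0 by apply: (row_free_inj freeD); rewrite mul0mx.
(* For [T = 0], [T^-1 = 0], but then [D0] has no columns. *)
case: T D0 freeD vPsi0 => [|T] D0 freeD vPsi0; first exact: thinmx0.
have vG0 : v *m (D0 *m D0^T + sigma_w ^+ 2 *: Omega) = 0.
  move: vPsi0; rewrite /Psi_mx -scalemxAr => /eqP.
  by rewrite scaler_eq0 invr_eq0 pnatr_eq0 /= => /eqP.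
apply: mulmx_tr_le0; rewrite trmx_mul.
have /(congr1 (fun M : 'M_1 => M 0 0)) :
    v *m (D0 *m D0^T + sigma_w ^+ 2 *: Omega) *m v^T = 0.
  by rewrite vG0 mul0mx.
rewrite mulmxDr mulmxDl -scalemxAr -scalemxAl !mulmxA => eq0.
have := psdO v^T; rewrite trmxK => vOv_ge0.
have {eq0} : (v *m D0 *m D0^T *m v^T) 0 0
    + sigma_w ^+ 2 * (v *m Omega *m v^T) 0 0 = 0.
  by move: eq0; rewrite !mxE.
by move/eqP; rewrite addr_eq0 => /eqP ->; rewrite oppr_le0 mulr_ge0 ?sqr_ge0.
Qed.

Definition direct_of_indirect (F : realType) (m n : nat) (Psi : 'M[F]_(m + n))
    (p : 'M[F]_(m, n) * 'M[F]_n) : 'M[F]_(m + n, n) * 'M[F]_n :=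
  (invmx Psi *m col_mx p.1 1%:M, p.2).

Lemma usubmx_direct_of_indirect (F : realType) (m n : nat)
    (Psi : 'M[F]_(m + n)) (K : 'M[F]_(m, n)) :
  Psi \in unitmx -> usubmx Psi *m (invmx Psi *m col_mx K 1%:M) = K.
Proof. by move=> uPsi; rewrite mul_usub_mx mulKVmx // col_mxKu. Qed.

(** Stacking [Psi_1 V] on [I = Psi_2 V] rebuilds [Psi V], from which [Psi^-1] recovers [V]. This is
    the surjectivity of [direct_of_indirect] onto feasible pairs. *)
Lemma direct_feasible_ex (F : realType) (m n : nat) (sigma_w : F)
    (Psi : 'M[F]_(m + n)) (X1bar : 'M[F]_(n, m + n)) (V : 'M[F]_(m + n, n))
    (Sigma : 'M[F]_n) :
  Psi \in unitmx -> direct_feasible sigma_w Psi X1bar (V, Sigma) ->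
  V = invmx Psi *m col_mx (usubmx Psi *m V) 1%:M.
Proof.
by move=> uPsi [_ _ ->]; rewrite -mul_col_mx vsubmxK mulKmx.
Qed.

(** With [V = Psi^-1 [K; I]], the closed-loop matrix [X1bar Psi^-1 [K; I]] is [X1bar V], so the
    covariance equations agree, and [Psi_2 V = I] holds by construction. *)
Lemma direct_of_indirect_feasible (F : realType) (m n : nat) (sigma_w : F)
    (Psi : 'M[F]_(m + n)) (X1bar : 'M[F]_(n, m + n))
    (p : 'M[F]_(m, n) * 'M[F]_n) :
  Psi \in unitmx ->
  indirect_feasible sigma_w (lsubmx (X1bar *m invmx Psi))
    (rsubmx (X1bar *m invmx Psi)) p <->
  direct_feasible sigma_w Psi X1bar (direct_of_indirect Psi p).
Proof.
case: p => K Sigma uPsi; rewrite /= hsubmxK.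
have -> : dsubmx Psi *m (invmx Psi *m col_mx K 1%:M) = 1%:M.
  by rewrite mul_dsub_mx mulKVmx // col_mxKd.
rewrite !trmx_mul !mulmxA.
by split=> [[]|[]].
Qed.

(** The control terms agree by [Psi_1 V = K]. For the regularizer, [Psi V = [K; I]], symmetry of
    [Psi] gives [V^T = [K^T I] Psi^-1], and cyclicity of the trace brings this factor to the
    front. *)
Lemma direct_of_indirect_cost (F : realType) (m n : nat)
    (Q : 'M[F]_n) (R : 'M[F]_m) (lambda : F) (Psi : 'M[F]_(m + n))
    (p : 'M[F]_(m, n) * 'M[F]_n) :
  Psi^T = Psi -> Psi \in unitmx ->
  direct_cost Q R lambda Psi (direct_of_indirect Psi p)
  = indirect_cost Q R lambda Psi p.
Proof.
case: p => K Sigma symPsi uPsi; rewrite /direct_cost /indirect_cost /=.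
rewrite -trmx_mul -(mulmxA _ (usubmx Psi)) usubmx_direct_of_indirect //.
rewrite mulKVmx // trmx_mul trmx_inv symPsi tr_col_mx trmx1.
by rewrite [in LHS](mxtrace_mulC (_ *m Sigma)) !mulmxA.
Qed.

Theorem theorem2 (F : realType) (m n T : nat)
    (U0 : 'M[F]_(m, T)) (X0 X1 : 'M[F]_(n, T))
    (Bbar : 'M[F]_(n, m)) (Abar : 'M[F]_n)
    (OmegaB : 'M[F]_m) (OmegaA : 'M[F]_n)
    (Q : 'M[F]_n) (R : 'M[F]_m) (sigma_w lambda : F)
    (hD0 : \rank (col_mx U0 X0) = (n + m)%N)
    (hOmega : psdmx (block_mx OmegaB 0 0 OmegaA))
    (hQ : psdmx Q) (hR : pdmx R)
    (hsigma : 0 < sigma_w) (hlambda : 0 <= lambda) :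
  let D0 := col_mx U0 X0 in
  let Omega := block_mx OmegaB 0 0 OmegaA in
  let Psi := Psi_mx sigma_w D0 Omega in
  let X1bar := X1bar_mx sigma_w X1 D0 (row_mx Bbar Abar) Omega in
  let Bhat := lsubmx (X1bar *m invmx Psi) in
  let Ahat := rsubmx (X1bar *m invmx Psi) in
  forall (K : 'M[F]_(m, n)) (Sigma : 'M[F]_n),
    is_minimizer (indirect_feasible sigma_w Bhat Ahat)
                 (indirect_cost Q R lambda Psi) (K, Sigma)
    <->
    exists V : 'M[F]_(m + n, n),
      K = usubmx Psi *m V /\
      is_minimizer (direct_feasible sigma_w Psi X1bar)
                   (direct_cost Q R lambda Psi) (V, Sigma).
Proof.
move=> D0 Omega Psi X1bar Bhat Ahat K Sigma.
have symPsi : Psi^T = Psi by apply: Psi_mx_sym.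
have uPsi : Psi \in unitmx.
  by apply: Psi_mx_unit => //; rewrite /row_free hD0 addnC.
have minE p : is_minimizer (indirect_feasible sigma_w Bhat Ahat)
                (indirect_cost Q R lambda Psi) p <->
              is_minimizer (direct_feasible sigma_w Psi X1bar)
                (direct_cost Q R lambda Psi) (direct_of_indirect Psi p).
  apply: is_minimizer_img => {}p.
  - exact: direct_of_indirect_feasible.
  - case: p => V S /(direct_feasible_ex uPsi) eqV.
    by exists (usubmx Psi *m V, S); rewrite /direct_of_indirect /= -eqV.
  - exact: direct_of_indirect_cost.
split=> [/minE min_dir | [V [-> min_dir]]].
- exists (invmx Psi *m col_mx K 1%:M).
  by rewrite usubmx_direct_of_indirect.
(* A minimizer is feasible, so [V] must be the image of the gain [Psi_1 V], and [minE] applies to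
   it. *)
- have [/(direct_feasible_ex uPsi) eqV _] := min_dir.
  by apply/minE; rewrite /direct_of_indirect /= -eqV.
Qed.
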